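(* For every $n$ and every $t$, there exists an $n$-vertex unweighted directed graph $G=(V,E)$ with $\mathrm{diam}(G)=3(t+1)$ such that every subgraph $H=(V,E')$, $E'\subseteq E$, with $\mathrm{diam}(H)\le 5t+1$ contains $\Omega(n^{1.5}/t^{1.5})$ edges.
   Context: $d_G(u,v)$ is the directed shortest-path distance and $\mathrm{diam}(G)=\max_{u,v}d_G(u,v)$.
   Formalization: ''For every n and every t'' is proved for t ≥ 1 and n ≥ K(t+1) with an absolute constant K, because no n-vertex graph has diameter 3(t+1) when n ≤ 3t+3 and the bound is undefined at t = 0; in the omitted range with n < K(t+1) the bound is only a constant. *)

(* Defs.v *)
From HB Require Import structures.
From mathcomp Require Import all_boot all_order all_algebra.
Set Implicit Arguments. Unset Strict Implicit. Unset Printing Implicit Defensive.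

Definition arc (V : finType) (E : {set V * V}) : rel V :=
  fun x y => (x, y) \in E.

Definition dist_le (V : finType) (E : {set V * V}) (u v : V) (k : nat) : Prop :=
  exists p : seq V, [/\ path (arc E) u p, last u p = v & size p <= k].

Definition diam_le (V : finType) (E : {set V * V}) (D : nat) : Prop :=
  forall u v : V, dist_le E u v D.

Definition diam_eq (V : finType) (E : {set V * V}) (D : nat) : Prop :=
  diam_le E D /\ exists u v : V, ~ dist_le E u v D.-1.

(* Main.v *)
Require Import Defs.
From HB Require Import structures.
From mathcomp Require Import all_boot all_order all_algebra.
From mathcomp Require Import finfield zify ring lra.
Import Order.TTheory GRing.Theory Num.Theory.

Set Implicit Arguments. Unset Strict Implicit. Unset Printing Implicit Defensive.

(** Let [B] be the graph on the lines and points of the affine plane over a field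
with [q] elements, where a line is joined to its points, its parallels and itself.
Any two vertices of [B] are joined by a walk of length exactly 2 (two lines meet
or are parallel, two points lie on a line, a point has a parallel to any line
through it), but an incidence of [x] and [y] lies in no cycle of length 3 or 4,
because [y] lies on one line of each parallel class and two lines share at most
one point; without the arc from [x] to [y] their distance is therefore at least 4.
Replace every vertex by a directed path with [t + 1] vertices, so that each step
of [B] costs [t + 1]: distances become at most [2(t + 1) + t], whereas deleting
any of the more than [q^3] arcs from a line to one of its points creates a
distance of at least [4(t + 1) + t > 5t + 1]. Padding vertices hung at the end
of one path raise the diameter to exactly [3(t + 1)] and the order to [n], and
taking [q] a power of 2 makes [q^2] comparable to [n / t]. *)

(** * Bounded reachability and potentials *)

Definition reach (T : eqType) (e : rel T) (u v : T) (k : nat) : Prop :=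
  exists p : seq T, [/\ path e u p, last u p = v & size p <= k].

Lemma reach_leq (T : eqType) (e : rel T) u v k l :
  reach e u v k -> k <= l -> reach e u v l.
Proof. by move=> [p [pp lp sp]] le_kl; exists p; split=> //; apply: leq_trans le_kl. Qed.

Lemma reach1 (T : eqType) (e : rel T) u v : e u v -> reach e u v 1.
Proof. by move=> euv; exists [:: v]; rewrite /= euv. Qed.

Lemma reach_trans (T : eqType) (e : rel T) u v w k l :
  reach e u v k -> reach e v w l -> reach e u w (k + l).
Proof.
move=> [p [pp <- sp]] [p' [pp' <- sp']]; exists (p ++ p').
by rewrite cat_path pp pp' last_cat size_cat leq_add.
Qed.

Lemma reach_map (T T' : eqType) (e : rel T) (e' : rel T') (f : T -> T') u v k :
  {homo f : x y / e x y >-> e' x y} -> reach e u v k -> reach e' (f u) (f v) k.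
Proof.
move=> fe [p [pp <- sp]]; exists (map f p).
by rewrite last_map size_map; split=> //; apply: homo_path pp.
Qed.

(** An arc raises [psi] by at most one, so a gap in [psi] bounds a distance from below; both lower
    bounds on distances come from here. *)
Lemma reach_potential (T : eqType) (e : rel T) (psi : T -> nat) u v k :
  (forall a b, e a b -> psi b <= (psi a).+1) ->
  reach e u v k -> psi v <= psi u + k.
Proof.
move=> He [p [pp <- sp]]; apply: (@leq_trans (psi u + size p)); last by rewrite leq_add2l.
elim: p u pp {sp} => [|w p IHp] u /=; first by rewrite addn0.
by move=> /andP[/He euw /IHp]; lia.
Qed.

(** * Replacing vertices by chains *)

Definition vert (S : finType) (t r : nat) : finType := ((S * 'I_t.+1) + 'I_r)%type.

(* A step of [R] costs [t.+1]: one runs through the chain [(s, 0), ..., (s, t)]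
   before jumping to the start of the chain of an [R]-neighbour. The [r] padding
   vertices act as an additional last vertex of the chain of [s0]. *)
Definition chain_arc (S : finType) (R : rel S) (s0 : S) (t r : nat) : rel (vert S t r) :=
  fun u v => match u, v with
  | inl (s, i), inl (s', j) =>
      (s == s') && (j == i.+1 :> nat) || [&& i == t :> nat, j == 0 :> nat & R s s']
  | inl (s, i), inr _ => (s == s0) && (i == t :> nat)
  | inr _, inl (s', j) => (j == 0 :> nat) && R s0 s'
  | inr _, inr _ => false
  end.

Section Chains.
Context (S : finType) (R : rel S) (s0 : S) (t r : nat).
Let e := @chain_arc S R s0 t r.

Lemma reach_chain (s : S) (i j : 'I_t.+1) :
  i <= j -> reach e (inl (s, i)) (inl (s, j)) (j - i).
Proof.
case: j => j lt_jt /=; elim: j lt_jt => [|j IHj] lt_jt le_ij.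
  have -> : i = Ordinal lt_jt by apply: val_inj => /=; lia.
  by exists [::].
have [le_ij'|lt_ji] := leqP i j; last first.
  have -> : i = Ordinal lt_jt by apply: val_inj => /=; lia.
  by exists [::].
rewrite subSn // -[(j - i).+1]addn1; apply: reach_trans (IHj (ltnW lt_jt) le_ij') _.
by apply: reach1; rewrite /e /= !eqxx.
Qed.

Lemma reach_jump (s s' : S) (i : 'I_t.+1) :
  R s s' -> reach e (inl (s, i)) (inl (s', ord0)) (t - i).+1.
Proof.
move=> Rss'; rewrite -[(t - i).+1]addn1; have climb := reach_chain s (leq_ord i : i <= @ord_max t).
by apply: reach_trans climb _; apply: reach1; rewrite /e /= !eqxx Rss' orbT.
Qed.

(** Two jumps cost at most [t + 1] each and the final climb at most [t]; a padding target costs one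
    further arc. *)
Lemma chain_diam :
  (forall s s', exists2 m, R s m & R m s') ->
  forall u v, reach e u v (3 * (t + 1)).
Proof.
move=> R2 u v.
have two s s' (i : 'I_t.+1) : reach e (inl (s, i)) (inl (s', ord0)) (2 * t + 2).
  have [m Rsm Rms'] := R2 s s'.
  apply: reach_leq (reach_trans (reach_jump i Rsm) (reach_jump ord0 Rms')) _.
  by rewrite /=; lia.
have up s (j : 'I_t.+1) : reach e (inl (s, ord0)) (inl (s, j)) t.
  by apply: reach_leq (reach_chain s (leq0n j : @ord0 t <= j)) _; case: j => j /=; lia.
have out (a : 'I_r) s : reach e (inr a) (inl (s, ord0)) (t + 2).
  have [m Rm Rms] := R2 s0 s.
  have step : reach e (inr a) (inl (m, ord0)) 1 by apply: reach1; rewrite /e /= Rm.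
  by apply: reach_leq (reach_trans step (reach_jump ord0 Rms)) _ => /=; lia.
have last (a : 'I_r) : reach e (inl (s0, ord_max)) (inr a) 1.
  by apply: reach1; rewrite /e /= !eqxx.
case: u v => [[s i]|a] [[s' j]|b].
- by apply: reach_leq (reach_trans (two s s' i) (up s' j)) _; lia.
- by apply: reach_leq (reach_trans (reach_trans (two s s0 i) (up s0 ord_max)) (last b)) _; lia.
- by apply: reach_leq (reach_trans (out a s') (up s' j)) _; lia.
- by apply: reach_leq (reach_trans (reach_trans (out a s0) (up s0 ord_max)) (last b)) _; lia.
Qed.

(** Padding gets the value that a position [t.+1] on the chain of [s0] would have. *)
Definition chain_potential (delta : S -> nat) (u : vert S t r) : nat :=
  match u with
  | inl (s, i) => delta s * t.+1 + i
  | inr _ => (delta s0).+1 * t.+1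
  end.

Lemma chain_potential_arc (delta : S -> nat) :
  (forall s s', R s s' -> delta s' <= (delta s).+1) ->
  forall u v, e u v -> chain_potential delta v <= (chain_potential delta u).+1.
Proof.
move=> lip [[s i]|a] [[s' j]|b] //=.
- case/orP=> [/andP[/eqP <- /eqP ->]|/and3P[/eqP -> /eqP -> /lip le_s]]; first by lia.
  by have := leq_mul le_s (leqnn t.+1); rewrite mulSn; lia.
- by move=> /andP[/eqP -> /eqP ->]; rewrite mulSn; lia.
- case/andP=> /eqP -> /lip le_s.
  by have := leq_mul le_s (leqnn t.+1); lia.
Qed.

End Chains.

(** * Lines and points of the affine plane *)

(** [(Some m, c)] is the line of slope [m] and intercept [c], and [(None, c)] a vertical line, so
    the first component is the parallel class. *)
Definition inc (F : finFieldType) (x : option F * F) (y : F * F) : bool :=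
  if x.1 is Some m then y.2 == (m * y.1 + x.2)%R else y.1 == x.2.

Definition station (F : finFieldType) : finType := ((option F * F) + (F * F))%type.

Definition adj (F : finFieldType) : rel (station F) :=
  fun s s' => match s, s' with
  | inl x, inl x' => x.1 == x'.1
  | inl x, inr y | inr y, inl x => inc x y
  | inr _, inr _ => false
  end.

Section Plane.
Context (F : finFieldType).
Implicit Types (x : option F * F) (y : F * F).

Lemma parallel_through x y : exists2 x', x.1 = x'.1 & inc x' y.
Proof.
case: x => [[m|] c]; last by exists (None, y.1) => //=; apply: eqxx.
by exists (Some m, y.2 - m * y.1)%R => //; rewrite /inc /=; apply/eqP; ring.
Qed.

Lemma line_through y y' : exists2 x, inc x y & inc x y'.
Proof.
case: y y' => [a b] [a' b']; have [->|neq_a] := eqVneq a a'.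
  by exists (None, a'); apply: eqxx.
have nz : (a - a' != 0)%R by rewrite subr_eq0.
pose m := ((b - b') / (a - a'))%R.
by exists (Some m, b - m * a)%R; rewrite /inc /=; apply/eqP; rewrite /m; field.
Qed.

Lemma lines_meet x x' : x.1 != x'.1 -> exists2 y, inc x y & inc x' y.
Proof.
case: x x' => [[m|] c] [[m'|] c'] //= neq_m.
- have nz : (m - m' != 0)%R by rewrite subr_eq0; apply: contraNneq neq_m => ->.
  pose a := ((c' - c) / (m - m'))%R.
  by exists (a, m * a + c)%R; rewrite /inc /=; apply/eqP; rewrite /a //; field.
- by exists (c', m * c' + c)%R; rewrite /inc /= eqxx.
- by exists (c, m' * c + c')%R; rewrite /inc /= eqxx.
Qed.

Lemma parallel_inc x x' y : x.1 = x'.1 -> inc x y -> inc x' y -> x = x'.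
Proof.
case: x x' => [[m|] c] [m' c'] /= <-; rewrite /inc /= => /eqP H /eqP.
  by rewrite H => /addrI ->.
by rewrite H => ->.
Qed.

Lemma two_common_points x x' y y' :
  inc x y -> inc x y' -> inc x' y -> inc x' y' -> y != y' -> x = x'.
Proof.
move=> xy xy' x'y x'y' neq_y.
suff: x.1 = x'.1 by move=> par; apply: parallel_inc par xy x'y.
move: xy xy' x'y x'y' neq_y; case: x x' y y' => [m c] [m' c'] [a b] [a' b'].
case: m m' => [m|] [m'|]; rewrite /inc //= => /eqP-> /eqP-> /eqP E /eqP E'.
- rewrite xpair_eqE => neq.
  have neq_a : (a - a' != 0)%R.
    by rewrite subr_eq0; apply: contraNneq neq => ->; rewrite !eqxx.
  congr Some; apply: (mulIf neq_a); apply/eqP; rewrite -subr_eq0; apply/eqP.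
  transitivity (((m * a + c) - (m * a' + c)) - (m' * (a - a')))%R; first by ring.
  by rewrite E E'; ring.
- by rewrite E E' eqxx.
- by rewrite E E' eqxx.
Qed.

Lemma adj_two_steps (s s' : station F) : exists2 m, adj s m & adj m s'.
Proof.
case: s s' => [x|y] [x'|y'].
- have [par|/lines_meet[y xy x'y]] := eqVneq x.1 x'.1; last by exists (inr y).
  by exists (inl x) => /=; apply/eqP.
- by have [x' par x'y] := parallel_through x y'; exists (inl x') => //=; apply/eqP.
- by have [x par xy] := parallel_through x' y; exists (inl x) => //=; apply/eqP.
- by have [x xy xy'] := line_through y y'; exists (inl x).
Qed.

(* Distance from the line [x] in the station graph once the arc from [x] to [y]
   has been removed. *)
Definition detour x y (s : station F) : nat :=
  match s with
  | inl x' => if x' == x then 0 else if x'.1 == x.1 then 1 else if inc x' y then 3 else 2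
  | inr y' => if y' == y then 4 else if inc x y' then 1 else 2
  end.

(** Two steps are delicate. A line other than [x] entering [y] is not parallel to [x], so it has
    value 3. A point of [x] other than [y] lies on no other line through [y], so no step goes from 1
    to 3. *)
Lemma detour_adj x y (s s' : station F) :
  inc x y -> adj s s' -> (s, s') != (inl x, inr y) ->
  detour x y s' <= (detour x y s).+1.
Proof.
move=> xy; case: s s' => [x1|y1] [x2|y2] //=.
- move=> /eqP eq_x _; rewrite -eq_x.
  case: (x2 == x) => //; have [->|_] := eqVneq x1 x; first by rewrite eqxx.
  by case: (x1.1 == x.1) => //; do 2?case: ifP.
- move=> inc12 neq; have [eq_y|neq_y] := eqVneq y2 y; last first.
    by have [<-|_] := eqVneq x1 x; [rewrite inc12 | do 3?case: ifP].
  move: neq inc12; rewrite eq_y xpair_eqE => + inc1.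
  have [->|neq_x] := eqVneq x1 x; first by rewrite !eqxx.
  move=> _; case: eqP => [par|_]; last by rewrite inc1.
  by rewrite (parallel_inc par inc1 xy) eqxx in neq_x.
- move=> inc21 _; have [//|neq_y] := eqVneq y1 y; first by do 3?case: ifP.
  have [//|neq_x] := eqVneq x2 x; case: eqP => // _.
  case: ifP => inc2; last by case: ifP.
  case: ifP => // incx.
  by rewrite (two_common_points inc21 inc2 incx xy neq_y) eqxx in neq_x.
Qed.

Lemma incidence_arc_critical (t r : nat) (y0 : F * F) (e : rel (vert (station F) t r)) x y :
  subrel e (@chain_arc _ (@adj F) (inr y0) t r) ->
  (forall u v, reach e u v (5 * t + 1)) -> inc x y ->
  e (inl (inl x, ord_max)) (inl (inr y, ord0)).
Proof.
move=> sub_e diam_e xy; apply: contraT => not_e.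
pose R' : rel (station F) := fun s s' => adj s s' && ((s, s') != (inl x, inr y)).
have eR' : subrel e (@chain_arc _ R' (inr y0) t r).
  move=> u v euv; have := sub_e _ _ euv; rewrite /chain_arc.
  case: u v euv => [[s i]|a] [[s' j]|b] //= euv.
    case/orP=> [->//|/and3P[it j0 Rss']].
    rewrite it j0 /R' Rss' /=; apply/orP; right.
    apply: contraNneq not_e => -[Es Es'].
    have -> : ord_max = i by apply: val_inj; rewrite /= (eqP it).
    have -> : ord0 = j by apply: val_inj; rewrite /= (eqP j0).
    by rewrite -Es -Es'.
  (* Padding jumps start from the point [y0], whereas the deleted pair starts from a line. *)
  by move=> /andP[-> Rss']; rewrite /R' /= Rss'.
have lip s s' : R' s s' -> detour x y s' <= (detour x y s).+1.
  by move=> /andP[]; apply: detour_adj.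
have arcs u v (euv : e u v) := chain_potential_arc lip (eR' u v euv).
have := reach_potential arcs
  (diam_e (inl (inl x, ord0)) (inl (inr y, ord_max))).
by rewrite /= !eqxx; lia.
Qed.

Lemma padding_far (t r : nat) (y0 y1 : F * F) (a : 'I_r) :
  y1 != y0 ->
  ~ reach (@chain_arc _ (@adj F) (inr y0) t r) (inl (inr y1, ord0)) (inr a) (3 * (t + 1)).-1.
Proof.
move=> neq_y.
(* The distance from [y1] capped at 2; distinct points are not adjacent, so [y0] gets 2 and padding
   gets [3 * t.+1]. *)
pose delta (s : station F) := if s == inr y1 then 0 else if adj (inr y1) s then 1 else 2.
have lip s s' : adj s s' -> delta s' <= (delta s).+1.
  rewrite /delta => Rss'; have [Es|_] := eqVneq s (inr y1).
    by rewrite -Es Rss'; case: ifP.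
  by do 3?case: ifP.
have arcs := @chain_potential_arc _ _ (inr y0) t r _ lip.
move=> /(reach_potential arcs); rewrite /= /delta eqxx /=.
have -> : (inr y0 == inr y1 :> station F) = false.
  by rewrite eq_sym; apply/eqP=> -[] /eqP; rewrite (negPf neq_y).
by lia.
Qed.

End Plane.

(** * Transfer to [n] vertices and choice of the field *)

Lemma card_station (F : finFieldType) : #|station F| = 2 * #|F| ^ 2 + #|F|.
Proof. by rewrite card_sum !card_prod card_option; move: #|F| => q; lia. Qed.

Lemma plane_digraph (F : finFieldType) (t n : nat) :
  3 * #|F| ^ 2 * t.+1 < n ->
  exists E : {set 'I_n * 'I_n},
    diam_eq E (3 * (t + 1)) /\
    forall E' : {set 'I_n * 'I_n}, E' \subset E -> diam_le E' (5 * t + 1) ->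
      #|F| ^ 3 <= #|E'|.
Proof.
(* The strict bound leaves at least one padding vertex, which is what attains the diameter. *)
move=> lt_n; pose r := n - #|station F| * t.+1.
have F_gt0 : 0 < #|F| by apply/card_gt0P; exists 0%R.
have le_st : #|station F| <= 3 * #|F| ^ 2 by rewrite card_station; nia.
have lt_st : #|station F| * t.+1 < n by apply: leq_ltn_trans lt_n; rewrite leq_mul2r le_st orbT.
have : n = #|vert (station F) t r|.
  by rewrite card_sum card_prod !card_ord /r subnKC // ltnW.
have : 0 < r by rewrite subn_gt0.
move: r => r r_gt0 {lt_n le_st lt_st} ->.
set T := vert _ _ _; pose y0 : F * F := (0, 0)%R.
pose arcs : rel T := @chain_arc _ (@adj F) (inr y0) t r.
pose g : 'I_#|T| -> T := enum_val.
pose h : T -> 'I_#|T| := enum_rank.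
have hK : cancel h g by apply: enum_rankK.
have gK : cancel g h by apply: enum_valK.
exists [set p | arcs (g p.1) (g p.2)]; split; first split.
- move=> u v; rewrite -[u]gK -[v]gK.
  apply: (@reach_map _ _ arcs); last by apply: chain_diam; apply: adj_two_steps.
  by move=> a b ab; rewrite /Defs.arc inE /= !hK.
- pose y1 : F * F := (1, 0)%R.
  have neq_y : y1 != y0 by rewrite xpair_eqE oner_eq0.
  exists (h (inl (inr y1, ord0))), (h (inr (Ordinal r_gt0))) => near.
  apply: (@padding_far F t r y0 y1 (Ordinal r_gt0) neq_y).
  rewrite -[inl _]hK -[inr (Ordinal _)]hK; apply: reach_map near.
  by move=> a b; rewrite /Defs.arc inE.
move=> E' /subsetP subE' diamE'.
pose e' : rel T := fun u v => (h u, h v) \in E'.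
have sub_e' : subrel e' arcs by move=> u v /subE'; rewrite inE /= !hK.
have diam_e' u v : reach e' u v (5 * t + 1).
  rewrite -[u]hK -[v]hK; apply: reach_map (diamE' (h u) (h v)).
  by move=> a b; rewrite /Defs.arc /e' !gK.
(* A slope [m] and a point [(a, b)] determine a non-vertical incidence, hence [#|F| ^ 3] critical
   arcs. *)
pose f (p : F * F * F) : 'I_#|T| * 'I_#|T| :=
  let: (m, a, b) := p in
  (h (inl (inl (Some m, b - m * a)%R, ord_max)), h (inl (inr (a, b), ord0))).
have f_inj : injective f.
  by move=> [[m a] b] [[m' a'] b'] [/(can_inj hK)[-> _] /(can_inj hK)[-> ->]].
have -> : #|F| ^ 3 = #|f @: setT|.
  by rewrite card_imset // cardsT !card_prod; move: #|F| => q; lia.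
apply: subset_leq_card; apply/subsetP=> _ /imsetP[[[m a] b] _ ->].
apply: (incidence_arc_critical sub_e' diam_e').
by rewrite /inc /=; apply/eqP; ring.
Qed.

(* Omega(n^1.5 / t^1.5) with c > 0 uniform in n and t:
   c * n^(3/2) / t^(3/2) <= |E'|  <=>  c^2 * n^3 <= |E'|^2 * t^3  (c > 0). *)
Theorem theorem7p3 :
  exists (c : rat) (K : nat), (0 < c)%R /\
  forall t n : nat, (1 <= t)%N -> (K * (t + 1) <= n)%N ->
  exists E : {set 'I_n * 'I_n},
    diam_eq E (3 * (t + 1)) /\
    forall E' : {set 'I_n * 'I_n}, E' \subset E -> diam_le E' (5 * t + 1) ->
      (c ^+ 2 * (n ^ 3)%:R <= ((#|E'| ^ 2) * t ^ 3)%:R :> rat)%R.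
Proof.
(* [576 = 24^2], where [n <= 12 q^2 (t + 1) <= 24 q^2 t] for the largest [q = 2^k]
   with [3 q^2 (t + 1) < n]; [13] makes [q = 2] admissible. *)
exists (1 / 576)%R, 13; split; first by lra.
move=> t n t_gt0 le_n.
pose small k := (0 < k) && (3 * (2 ^ k) ^ 2 * t.+1 < n).
have ex_small : exists k, small k by exists 1; rewrite /small /=; lia.
have small_bound k : small k -> k <= n.
  move=> /andP[_ lt_n]; have := ltn_expl k (isT : 1 < 2).
  by move: (2 ^ k) lt_n => q; nia.
case: (ex_maxnP ex_small small_bound) => k /andP[k_gt0 lt_n] max_k.
have le_n' : n <= 12 * (2 ^ k) ^ 2 * t.+1.
  rewrite leqNgt; apply/negP=> lt_n'.
  suff /max_k : small k.+1 by rewrite ltnn.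
  by rewrite /small /= (expnS 2 k) expnMn; lia.
have [F _ cardF] := pPrimePowerField (isT : prime 2) k_gt0.
rewrite -cardF in lt_n le_n'.
have [E [diamE boundE]] := plane_digraph lt_n.
exists E; split=> [|E' subE' diamE']; first exact: diamE.
have le_E' := boundE E' subE' diamE'.
have le_n24 : n <= 24 * #|F| ^ 2 * t by apply: leq_trans le_n' _; nia.
(* Cubing turns [#|F| ^ 2] into the square of [#|F| ^ 3], which is at most [#|E'| ^ 2]. *)
have le_n3 : n ^ 3 <= 24 ^ 3 * (#|E'| ^ 2 * t ^ 3).
  apply: (@leq_trans ((24 * #|F| ^ 2 * t) ^ 3)); first by rewrite leq_exp2r.
  rewrite 2!expnMn expnAC -mulnA leq_mul2l leq_mul2r.
  by rewrite leq_exp2r ?le_E' ?orbT.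
have : ((n ^ 3)%:R <= 24 ^+ 3 * (#|E'| ^ 2 * t ^ 3)%:R :> rat)%R.
  by rewrite -natrX -natrM ler_nat.
have : (0 <= (#|E'| ^ 2 * t ^ 3)%:R :> rat)%R by apply: ler0n.
move: ((n ^ 3)%:R)%R ((#|E'| ^ 2 * t ^ 3)%:R)%R => a b.
(* Here [c ^+ 2] is [24 ^ -4], which absorbs the factor [24 ^ 3] since [b] is nonnegative. *)
by lra.
Qed.
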